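(* Let $1\le k<n$ and let $\Delta(k,n)=\{x\in[0,1]^n:\sum_{i=1}^n x_i=k\}$. Let $A_1\sqcup A_2\sqcup A_3=[n]$ be a partition and $\mu_1,\mu_2,\mu_3\in\mathbb N$ with $\mu_1+\mu_2+\mu_3=k$ and $1\le\mu_j\le|A_j|-1$ for $j=1,2,3$. Consider the two subdivisions of $\Delta(k,n)$ whose maximal cells are, respectively, $P_1=\{x\in\Delta(k,n):\sum_{i\in A_3}x_i\le\mu_3,\ \sum_{i\in A_2}x_i\ge\mu_2\}$, $P_2=\{x\in\Delta(k,n):\sum_{i\in A_1}x_i\le\mu_1,\ \sum_{i\in A_3}x_i\ge\mu_3\}$, $P_3=\{x\in\Delta(k,n):\sum_{i\in A_2}x_i\le\mu_2,\ \sum_{i\in A_1}x_i\ge\mu_1\}$, and the same three sets with every ''$\le$'' replaced by ''$\ge$'' and vice versa. (These are $3$-splits of $\Delta(k,n)$.) Both of these subdivisions are matroid subdivisions, i.e. every cell of them is a matroid polytope.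
   Context: $[n]=\{1,\dots,n\}$. For a matroid $\mathcal M$ on $[n]$, its matroid polytope is the convex hull of the characteristic vectors in $\mathbb R^n$ of the bases of $\mathcal M$. A subdivision of the polytope $\Delta(k,n)$ is a polyhedral subdivision using only vertices of $\Delta(k,n)$ (the 0/1-vectors with exactly $k$ ones); it is a matroid subdivision if all of its cells are matroid polytopes. A $3$-split of a polytope is a coarsest subdivision (one admitting no non-trivial coarsening other than itself) with exactly $3$ maximal cells having an interior face of codimension $2$. *)

(* Defs.v *)
From HB Require Import structures.
From mathcomp Require Import all_boot all_order all_algebra.
From mathcomp Require Import all_classical reals.

Set Implicit Arguments.
Unset Strict Implicit.
Unset Printing Implicit Defensive.

Import Order.TTheory GRing.Theory Num.Theory.

Local Open Scope classical_set_scope.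
Local Open Scope card_scope.
Local Open Scope ring_scope.

(* The ground set [n] = {1, ..., n} is represented by 'I_n, and R^n by row
   vectors 'rV[R]_n. *)

Record matroid (n : nat) := Matroid {
  bases : {set {set 'I_n}};
  bases_neq0 : bases != finset.set0;
  bases_exchange : forall X Y : {set 'I_n}, X \in bases -> Y \in bases ->
    forall x, x \in X :\: Y ->
      exists2 y, y \in Y :\: X & y |: (X :\ x) \in bases
}.

Section Polytopes.
Variables (R : realType) (n : nat).
Implicit Types (P Q F : set 'rV[R]_n) (Sigma : set (set 'rV[R]_n)).

Definition affine_hull (X : set 'rV[R]_n) : set 'rV[R]_n :=
  [set x | exists (m : nat) (p : 'I_m -> 'rV[R]_n) (a : 'I_m -> R),
     [/\ forall j, X (p j),
         \sum_j a j = 1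
       & x = \sum_j a j *: p j]].

Definition convex_hull (X : set 'rV[R]_n) : set 'rV[R]_n :=
  [set x | exists (m : nat) (p : 'I_m -> 'rV[R]_n) (a : 'I_m -> R),
     [/\ forall j, X (p j),
         forall j, 0 <= a j,
         \sum_j a j = 1
       & x = \sum_j a j *: p j]].

(* The affine hull of P is a translate of a d-dimensional linear subspace,
   given as the row space of B. *)
Definition has_dim P (d : nat) : Prop :=
  exists (x0 : 'rV[R]_n) (B : 'M[R]_(d, n)),
    row_free B /\ affine_hull P = [set x | (x - x0 <= B)%MS].

Definition polytope P : Prop :=
  exists2 X : set 'rV[R]_n, finite_set X & P = convex_hull X.

(* The empty set and P itself are faces of P. *)
Definition face P F : Prop :=
  exists (c : 'rV[R]_n) (b : R),
    (forall x, P x -> \sum_i c 0 i * x 0 i <= b) /\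
    F = P `&` [set x | \sum_i c 0 i * x 0 i = b].

Definition vertex P (v : 'rV[R]_n) : Prop := face P [set v].

Definition boundary P : set 'rV[R]_n :=
  [set x | exists F, [/\ face P F, F <> P & F x]].

(* Cells are nonempty by convention: a subdivision is identified with its set
   of nonempty faces. *)
Definition subdivision P Sigma : Prop :=
  [/\ finite_set Sigma,
      forall C, Sigma C ->
        [/\ polytope C, C !=set0 & forall v, vertex C v -> vertex P v],
      forall C F, Sigma C -> face C F -> F !=set0 -> Sigma F,
      forall C D, Sigma C -> Sigma D ->
        face C (C `&` D) /\ face D (C `&` D)
    & \bigcup_(C in Sigma) C = P].

Definition maximal_cells Sigma : set (set 'rV[R]_n) :=
  [set C | Sigma C /\ forall D, Sigma D -> C `<=` D -> C = D].

Definition face_complex (M : set (set 'rV[R]_n)) : set (set 'rV[R]_n) :=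
  [set F | F !=set0 /\ exists2 P, M P & face P F].

Definition trivial_subdivision P : set (set 'rV[R]_n) := face_complex [set P].

Definition coarsening Sigma' Sigma : Prop :=
  forall C, Sigma C -> exists2 D, Sigma' D & C `<=` D.

Definition coarsest_subdivision P Sigma : Prop :=
  [/\ subdivision P Sigma,
      Sigma <> trivial_subdivision P
    & forall Sigma', subdivision P Sigma' -> coarsening Sigma' Sigma ->
        Sigma' <> trivial_subdivision P -> Sigma' = Sigma].

Definition interior_cell P Sigma F : Prop := Sigma F /\ ~ F `<=` boundary P.

Definition has_codim P F (c : nat) : Prop :=
  exists2 d, has_dim F d & has_dim P (d + c)%N.

Definition three_split P Sigma : Prop :=
  [/\ coarsest_subdivision P Sigma,
      maximal_cells Sigma #= `I_3
    & exists2 F, interior_cell P Sigma F & has_codim P F 2].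

Definition char_vector (B : {set 'I_n}) : 'rV[R]_n :=
  \row_i (i \in B)%:R.

Definition matroid_polytope (M : matroid n) : set 'rV[R]_n :=
  convex_hull [set char_vector B | B in [set` bases M]].

Definition matroid_subdivision P Sigma : Prop :=
  subdivision P Sigma /\
  forall C, Sigma C -> exists M : matroid n, C = matroid_polytope M.

Definition hypersimplex (k : nat) : set 'rV[R]_n :=
  [set x | (forall i, 0 <= x 0 i <= 1) /\ \sum_i x 0 i = k%:R].

End Polytopes.

Arguments hypersimplex : clear implicits.

(* Main.v *)
Require Import Defs.
From HB Require Import structures.
From mathcomp Require Import all_boot all_order all_algebra.
From mathcomp Require Import finmap.
From mathcomp Require Import all_classical reals convex interval_inference.
From mathcomp Require Import zify ring lra.

Set Implicit Arguments.
Unset Strict Implicit.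
Unset Printing Implicit Defensive.

Import Order.TTheory GRing.Theory Num.Theory.

Local Open Scope classical_set_scope.
Local Open Scope ring_scope.

(** Write [y_j = x(A_j) - mu_j], so that [y_1 + y_2 + y_3 = 0] on the
    hypersimplex. With indices mod 3, the cell [i] is the preimage of the cone
    [y_(i+2) <= 0 <= y_(i+1)]; these three cones form a complete fan in the
    plane of the [y]'s.

    The coordinates, the blocks [A_j] and the ground set form a laminar family.
    At a fractional point, a smallest member with an integral sum and a
    fractional coordinate yields two fractional coordinates [l] and [m] such that
    moving both ways along [e_l - e_m] preserves all integral sums of the family;
    hence cells are convex hulls of 0/1 points. These 0/1 points satisfy the
    symmetric basis exchange property, which passes to the maximizers of a linear
    functional; hence all faces of cells are matroid polytopes.

    The subdivision is coarsest: a cell [D] of a coarsening contains every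
    [cell j] that it meets in a relative interior point. If [D] contains
    [cell i] and a point outside it, then a midpoint of that point with a point
    on a wall of [cell i] is interior to a neighbouring cell; and two cells
    contained in [D] force the third in the same way, so [D] is the whole
    hypersimplex. *)

Local Notation convex S := (convex_set (S : set (convex_lmodType _))).

(** * Convex sets and feasible directions *)

Section Convexity.
Variables (R : realFieldType) (V : lmodType R).
Implicit Types (S T : set V) (x z v : V) (f : {scalar V}) (a t : R).

Lemma convex_setP S : convex S <->
  forall x z t, S x -> S z -> 0 <= t <= 1 -> S (t *: x + (1 - t) *: z).
Proof.
split=> [cS x z t Sx Sz /andP[t0 t1]|cS x z t].
  by apply/set_mem/(cS x z (Itv01 t0 t1)); exact/mem_set.
by rewrite !inE => Sx Sz; apply: cS => //; apply/andP; split.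
Qed.

Lemma convex_set_sum S (I : finType) (p : I -> V) (a : I -> R) :
  convex S -> (forall i, S (p i)) ->
  (forall i, 0 <= a i) -> \sum_i a i = 1 -> S (\sum_i a i *: p i).
Proof.
move=> /convex_setP cS Sp a0 a1.
suff weighted_mean r : 0 < \sum_(i <- r) a i ->
    S ((\sum_(i <- r) a i)^-1 *: \sum_(i <- r) a i *: p i).
  by have := weighted_mean (index_enum I); rewrite a1 invr1 scale1r; apply.
elim: r => [|i r IH]; rewrite ?big_nil ?ltxx// !big_cons.
have : 0 <= \sum_(j <- r) a j by apply: sumr_ge0.
rewrite le_eqVlt => /orP[/eqP/esym/eqP s0|s_gt0 _].
  rewrite (eqP s0) addr0 => ai_gt0; rewrite big_seq big1 ?addr0.
    by rewrite scalerA mulVf ?gt_eqF// scale1r.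
  move=> j jr; move: s0; rewrite psumr_eq0// => /allP/(_ _ jr)/= /eqP->.
  by rewrite scale0r.
have ai0 := a0 i.
set s := \sum_(j <- r) a j in IH s_gt0 *; set y := \sum_(j <- r) a j *: p j.
suff -> : (a i + s)^-1 *: (a i *: p i + y) =
    (a i / (a i + s)) *: p i + (1 - a i / (a i + s)) *: (s^-1 *: y).
  apply: cS => //; first exact: IH.
  by rewrite divr_ge0 ?addr_ge0 ?(ltW s_gt0)//= ler_pdivrMr; lra.
rewrite scalerDr !scalerA; congr (_ *: _ + _ *: _); field.
  by rewrite gt_eqF//; lra.
by rewrite !gt_eqF//; lra.
Qed.

Definition midpoint x z := 2^-1 *: (x + z).

Lemma convex_set_midpoint S x z :
  convex S -> S x -> S z -> S (midpoint x z).
Proof.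
move=> /convex_setP cS Sx Sz; rewrite /midpoint scalerDr.
rewrite -[X in _ + X *: z](_ : 1 - 2^-1 = _); last by field.
by apply: cS => //; lra.
Qed.

Lemma convex_set_halfspace f a :
  convex [set x | f x <= a].
Proof.
apply/convex_setP => x z t /= fx fz /andP[t0 t1]; rewrite linearD !linearZ/=.
have := ler_wpM2l t0 fx; have : 0 <= 1 - t by lra.
by move=> /ler_wpM2l/(_ _ _ fz); lra.
Qed.

Definition feasible_direction S z v :=
  exists2 e, 0 < e & forall t, 0 <= t <= e -> S (z + t *: v).

Lemma feasible_directionI S T z v : feasible_direction S z v ->
  feasible_direction T z v -> feasible_direction (S `&` T) z v.
Proof.
move=> [d d0 Sd] [e e0 Te]; exists (Num.min d e); first by rewrite lt_min d0.
move=> t; rewrite le_min => /and3P[t0 td te].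
by split; [apply: Sd|apply: Te]; rewrite t0.
Qed.

Lemma feasible_direction_forall (I : finType) (S : I -> set V) z v :
  (forall i, feasible_direction (S i) z v) ->
  feasible_direction [set x | forall i, S i x] z v.
Proof.
move=> feasS.
have /choice[e eP] : forall i, exists e,
    0 < e /\ forall t, 0 <= t <= e -> S i (z + t *: v).
  by move=> i; have [e e0 Se] := feasS i; exists e.
exists (\big[Order.min/1]_i e i).
  by apply: lt_bigmin => // i _; have [] := eP i.
move=> t /andP[t0 te] i; apply: (eP i).2; rewrite t0.
exact/(le_trans te)/bigmin_le.
Qed.

Lemma feasible_direction_halfspace f a z v :
  f z < a -> feasible_direction [set x | f x <= a] z v.
Proof.
move=> fza; exists ((a - f z) / (1 + `|f v|)).
  by rewrite divr_gt0 ?subr_gt0// ltr_wpDr.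
move=> t /andP[t0]; rewrite ler_pdivlMr ?ltr_wpDr// => t_le.
rewrite /= linearD linearZ/=.
by have := ler_wpM2l t0 (ler_norm (f v)); lra.
Qed.

Lemma feasible_direction_level f a z v :
  f z = a -> f v = 0 -> feasible_direction [set x | f x = a] z v.
Proof.
by move=> fz fv; exists 1 => // t _; rewrite /= linearD linearZ/= fv mulr0 addr0.
Qed.

(* For convex sets this is the usual relative interior. *)
Definition relint S z :=
  S z /\ forall x, S x -> feasible_direction S z (z - x).

End Convexity.

(** * Faces of polytopes *)

Section Faces.
Variables (R : realType) (n : nat).
Implicit Types (x z v : 'rV[R]_n) (C D F G P S X : set 'rV[R]_n).

Lemma faceP C F : face C F <-> exists (f : {scalar 'rV[R]_n}) (b : R),
  (forall x, C x -> f x <= b) /\ F = C `&` [set x | f x = b].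
Proof.
split=> [[c [b [cb FE]]]|[f [b [fb ->]]]].
  have c_scalar : scalar (fun x : 'rV_n => \sum_i c 0 i * x 0 i).
    move=> t x z; rewrite mulr_sumr -big_split; apply: eq_bigr => i _.
    by rewrite !mxE mulrDr mulrCA.
  pose fM := GRing.isLinear.Build _ _ _ _ _ c_scalar.
  pose f : {scalar 'rV[R]_n} := HB.pack (fun x : 'rV_n => \sum_i c 0 i * x 0 i) fM.
  by exists f, b.
pose c := \row_i f 'e_i.
have cE x : \sum_i c 0 i * x 0 i = f x.
  rewrite [in RHS](row_sum_delta x) linear_sum; apply: eq_bigr => i _.
  by rewrite mxE linearZ/= mulrC.
exists c, b; split=> [x /fb|]; rewrite ?cE//.
by apply/seteqP; split=> x [Cx] /=; rewrite cE.
Qed.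

Lemma face_sub C F : face C F -> F `<=` C.
Proof. by case=> c [b [_ ->]] x []. Qed.

Lemma face_refl C : face C C.
Proof.
apply/faceP; exists \0, 0; split=> //; apply/seteqP; split=> x //; by case.
Qed.

Lemma face_restrict C D F : D `<=` C -> face C F -> face D (D `&` F).
Proof.
move=> DC [c [b [cb ->]]]; exists c, b; split=> [x /DC/cb//|].
by rewrite setIA; congr (_ `&` _); apply/setIidl.
Qed.

Lemma face_sum C F (I : finType) (p : I -> 'rV[R]_n) (a : I -> R) :
  face C F -> (forall i, C (p i)) -> (forall i, 0 <= a i) -> \sum_i a i = 1 ->
  F (\sum_i a i *: p i) -> forall i, 0 < a i -> F (p i).
Proof.
move=> /faceP[f [b [fb ->]]] Cp a0 a1 [_ /=]; rewrite linear_sum/= => fE i ai.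
split=> //=; have : \sum_j a j * (b - f (p j)) = 0.
  under eq_bigr do rewrite mulrBr.
  rewrite sumrB -mulr_suml a1 mul1r -[X in X - _]fE; apply/eqP; rewrite subr_eq0.
  by apply/eqP/eq_bigr => j _; rewrite linearZ.
have slack_ge0 j : 0 <= a j * (b - f (p j)) by rewrite mulr_ge0// subr_ge0 fb.
move=> /(psumr_eq0P (fun j _ => slack_ge0 j))/(_ i isT)/eqP.
by rewrite mulf_eq0 gt_eqF//= subr_eq0 => /eqP.
Qed.

Lemma convex_set_face C F : convex C -> face C F -> convex F.
Proof.
move=> /convex_setP cC /faceP[f [b [fb ->]]].
apply/convex_setP => x z t [Cx /= fx] [Cz /= fz] t01; split; first exact: cC.
by rewrite /= linearD !linearZ/= fx fz; ring.
Qed.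

(* A linear functional attaining its maximum over [S] at [z] cannot decrease
   towards any [x] in [S], since it would increase in the opposite direction. *)
Lemma face_relint_sub D F S z :
  face D F -> S `<=` D -> relint S z -> F z -> S `<=` F.
Proof.
move=> /faceP[f [b [fb ->]]] SD [Sz Srel] [_ /= fz] x Sx.
have Dx := SD x Sx; split=> //=; apply/le_anti; rewrite fb//=.
have [e e0 /(_ e)] := Srel x Sx; rewrite lexx ltW// => /(_ isT)/SD/fb.
by rewrite linearD linearZ linearB/= fz gerDl pmulr_rle0// subr_le0.
Qed.

Lemma relint_not_boundary P z : relint P z -> ~ boundary P z.
Proof.
move=> Pz [F [fF nF Fz]]; apply: nF; apply/seteqP.
by split; [exact: face_sub|exact: face_relint_sub fF _ Pz Fz].
Qed.

Lemma sub_convex_hull X : X `<=` convex_hull X.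
Proof.
move=> x Xx; exists 1%N, (fun=> x), (fun=> 1).
by split=> //; rewrite big_ord1 ?scale1r.
Qed.

Lemma convex_hull_sub X S : convex S ->
  X `<=` S -> convex_hull X `<=` S.
Proof.
move=> cS XS x [m [p [a [Xp a0 a1 ->]]]].
by apply: convex_set_sum => // j; exact: XS.
Qed.

Lemma convex_hull_nonempty X x : convex_hull X x -> X !=set0.
Proof.
case=> -[|m] [p [a [Xp _ a1 _]]]; last by exists (p ord0).
by move: a1; rewrite big_ord0 => /esym/eqP; rewrite oner_eq0.
Qed.

Lemma convex_set_convex_hull X : convex (convex_hull X).
Proof.
apply/convex_setP => _ _ t [m [p [a [Xp a0 a1 ->]]]] [m' [p' [a' [Xp' a'0 a'1 ->]]]].
move=> /andP[t0 t1].
pose q j := match fintype.split j with inl i => p i | inr i => p' i end.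
pose b j :=
  match fintype.split j with inl i => t * a i | inr i => (1 - t) * a' i end.
have splitl i : fintype.split (lshift m' i) = inl i by exact: (unsplitK (inl i)).
have splitr i : fintype.split (rshift m i) = inr i by exact: (unsplitK (inr i)).
exists (m + m')%N, q, b; split.
- by move=> j; rewrite /q; case: splitP.
- by move=> j; rewrite /b; case: splitP => i _; rewrite mulr_ge0// subr_ge0.
- rewrite /b big_split_ord/=; under eq_bigr do rewrite splitl.
  under [X in _ + X]eq_bigr do rewrite splitr.
  by rewrite -!mulr_sumr a1 a'1 !mulr1 addrC subrK.
- rewrite big_split_ord !scaler_sumr; congr (_ + _); apply: eq_bigr => i _.
    by rewrite /q /b splitl scalerA.
  by rewrite /q /b splitr scalerA.
Qed.

Lemma face_convex_hull X F :
  face (convex_hull X) F -> F = convex_hull (X `&` F).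
Proof.
move=> fF; apply/seteqP; split; last first.
  apply: convex_hull_sub => [|x []//].
  exact: convex_set_face (convex_set_convex_hull (X := X)) fF.
move=> x Fx; have [m [p [a [Xp a0 a1 xE]]]] := face_sub fF Fx.
have Fp j : 0 < a j -> F (p j).
  rewrite xE in Fx; apply: face_sum fF _ a0 a1 Fx j => i.
  exact/sub_convex_hull.
have [j0 aj0] : exists j, 0 < a j.
  apply: contrapT => /forallNP a_le0; suff : \sum_j a j <= 0 by rewrite a1 ler10.
  by apply: sumr_le0 => j _; rewrite leNgt; apply/negP.
exists m, (fun j => if 0 < a j then p j else p j0), a; split=> //.
  by move=> j; case: ifP => [/Fp|_]; split=> //; exact: Fp.
rewrite xE; apply: eq_bigr => j _; case: ltP => // aj.
by have -> : a j = 0 by [apply/le_anti; rewrite aj a0]; rewrite !scale0r.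
Qed.

Lemma vertex_convex_hull X v : vertex (convex_hull X) v -> X v.
Proof.
move=> /face_convex_hull vE.
have /convex_hull_nonempty[x [Xx xv]] : convex_hull (X `&` [set v]) v by rewrite -vE.
by rewrite -xv.
Qed.

Lemma convex_set_polytope C : polytope C -> convex C.
Proof. by case=> X _ ->; exact: convex_set_convex_hull. Qed.

Lemma polytope_face C F : polytope C -> face C F -> polytope F.
Proof.
case=> X finX -> /face_convex_hull ->; exists (X `&` F) => //.
exact: finite_setIl.
Qed.

Lemma finite_faces C : polytope C -> finite_set (face C).
Proof.
case=> X /finite_fsetP[A ->] ->.
pose hull (B : {fset 'rV[R]_n}) := convex_hull [set` B].
apply: (sub_finite_set (B := hull @` [set` fpowerset A])); last first.
  exact/finite_image/finite_fset.
move=> F /face_convex_hull FE; exists [fset x in A | `[< F x >]]%fset.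
  by rewrite /= fpowersetE; apply/fsubsetP => x; rewrite !inE => /andP[].
rewrite [RHS]FE; congr convex_hull; apply/seteqP; split=> x /=.
  by rewrite !inE => /andP[xA /asboolP].
by move=> [xA Fx]; rewrite !inE xA; apply/asboolP.
Qed.

(* If [f] cuts [F] out of [C] and [g] cuts [G] out of [F], then [N f + g] cuts
   [G] out of [C] as soon as [N] exceeds every ratio [(g v - e) / (b - f v)] at
   the generators [v] of [C] outside [F]. *)
Lemma polytope_face_trans C F G : polytope C -> face C F -> face F G -> face C G.
Proof.
move=> [X /finite_seqP[s ->] ->{C}]; set C := convex_hull _.
move=> /faceP[f [b [fb ->]]] /faceP[g [e [ge ->]]].
pose ratio v := (g v - e) / (b - f v).
pose N := \big[Order.max/0]_(v <- s) ratio v.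
have [h hE] : exists h : {scalar 'rV[R]_n}, forall x, h x = N * f x + g x.
  by exists (f \o *:%R N \+ g) => x /=; rewrite linearZ.
have h_le x : C x -> h x <= N * b + e.
  move: x; apply: convex_hull_sub; first exact: convex_set_halfspace.
  move=> v /= vs; rewrite hE; have Cv : C v by exact: sub_convex_hull.
  have := fb _ Cv; rewrite le_eqVlt => /orP[/eqP fv|fv].
    by rewrite fv lerD2l; exact: ge.
  have : ratio v <= N by exact: le_bigmax_seq.
  by rewrite ler_pdivrMr ?subr_gt0//; lra.
apply/faceP; exists (f \+ h), (b + (N * b + e)); split=> [x Cx|].
  by rewrite /= lerD ?fb ?h_le.
apply/seteqP; split=> x [].
  by move=> [Cx fx] gx; split=> //=; rewrite hE fx gx.
move=> Cx /= fhx; have fx_le := fb x Cx; have hx_le := h_le x Cx.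
have fx : f x = b by lra.
by split=> //=; rewrite hE fx in fhx; lra.
Qed.

Lemma has_dim_kernel m (M : 'M[R]_(n, m)) S z :
  S z -> (forall x, S x -> x *m M = z *m M) ->
  (forall v : 'rV_n, v *m M = 0 -> feasible_direction S z v) ->
  has_dim S (n - \rank M).
Proof.
move=> Sz SM feasS; rewrite -mxrank_ker.
exists z, (row_base (kermx M)); split; first exact: row_base_free.
apply/seteqP; split=> x /=; rewrite eq_row_base sub_kermx mulmxBl subr_eq0.
  move=> [l [p [a [Sp a1 ->]]]]; rewrite mulmx_suml.
  under eq_bigr do rewrite -scalemxAl SM//.
  by rewrite -scaler_suml a1 scale1r.
move=> /eqP xM; have [|e e0 Se] := feasS (x - z); first by rewrite mulmxBl xM subrr.
pose p (j : 'I_2) := if j == 0 then z + e *: (x - z) else z.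
pose a (j : 'I_2) := if j == 0 then e^-1 else 1 - e^-1.
exists 2, p, a; split.
- by move=> j; rewrite /p; case: ifP => // _; apply: Se; rewrite lexx ltW.
- by rewrite big_ord_recr big_ord1 /a/= addrC subrK.
- rewrite big_ord_recr big_ord1 /a /p/=.
  by apply/rowP => i; rewrite !mxE; field; rewrite gt_eqF.
Qed.

End Faces.

(** * Face complexes and their coarsenings *)

Section FaceComplex.
Variables (R : realType) (n : nat) (I : finType) (P : set 'rV[R]_n).
Variable cell : I -> set 'rV[R]_n.
Implicit Types (i j : I) (C D F : set 'rV[R]_n) (Sigma : set (set 'rV[R]_n)).

Lemma face_complex_cell i : cell i !=set0 -> face_complex (range cell) (cell i).
Proof. by split=> //; exists (cell i); [exists i|exact: face_refl]. Qed.

Lemma subdivision_face_complex :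
  (forall i, polytope (cell i)) ->
  (forall i v, vertex (cell i) v -> vertex P v) ->
  (forall i j, face (cell i) (cell i `&` cell j)) ->
  \bigcup_i cell i = P ->
  subdivision P (face_complex (range cell)).
Proof.
move=> poly_cell vertex_cell meet_cell cell_cover.
have face_meet C D : face_complex (range cell) C -> face_complex (range cell) D ->
    face C (C `&` D).
  move=> [_ [_ [i _ <-] fC]] [_ [_ [j _ <-] fD]].
  have -> : C `&` D = C `&` (cell i `&` cell j `&` D).
    apply/seteqP; split=> x [Cx]; last by case.
    by move=> Dx; do !split=> //; [exact: face_sub fC _ Cx|exact: face_sub fD _ Dx].
  apply: (face_restrict (face_sub fC)).
  apply: polytope_face_trans (poly_cell i) (meet_cell i j) _.
  exact: face_restrict (@subIsetr _ _ _) fD.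
split.
- apply: (sub_finite_set (B := \bigcup_i face (cell i))).
    by move=> F [_ [_ [i _ <-] fF]]; exists i.
  by apply: bigcup_finite => // i _; exact: finite_faces.
- move=> C [C0 [_ [i _ <-] fC]]; split=> //; first exact: polytope_face fC.
  by move=> v /(polytope_face_trans (poly_cell i) fC)/vertex_cell.
- move=> C F [_ [_ [i _ <-] fC]] fF F0; split=> //.
  exists (cell i); first by exists i.
  exact: polytope_face_trans fC fF.
- by move=> C D SC SD; split; [|rewrite setIC]; exact: face_meet.
- rewrite -cell_cover; apply/seteqP; split=> x.
    by move=> [C [_ [_ [i _ <-] /face_sub fC]] /fC]; exists i.
  by move=> [i _ ix]; exists (cell i) => //; apply: face_complex_cell; exists x.
Qed.

Lemma maximal_cells_face_complex :
  (forall i, cell i !=set0) -> (forall i j, cell i `<=` cell j -> i = j) ->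
  maximal_cells (face_complex (range cell)) = range cell.
Proof.
move=> cell0 antichain; apply/seteqP; split=> C.
  move=> [[_ [_ [i _ <-] /face_sub Ci]] maxC]; exists i => //.
  exact/esym/maxC/Ci/face_complex_cell.
move=> [i _ <-]; split=> [|D [_ [_ [j _ <-] /face_sub Dj]] iD].
  exact: face_complex_cell.
have /antichain ij := subset_trans iD Dj.
by apply/seteqP; split=> //; rewrite ij.
Qed.

(* An average of points of [C], one outside each face, lies in none of them. *)
Lemma convex_set_face_cover C (F : I -> set 'rV[R]_n) :
  convex C -> C !=set0 ->
  (forall i, face C (F i)) -> C `<=` \bigcup_i F i -> exists i, C `<=` F i.
Proof.
move=> cC [x0 Cx0] fF CF; apply: contrapT => /forallNP not_sub.
have /choice[x missed] : forall i, exists x, C x /\ ~ F i x.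
  move=> i; apply: contrapT => /forallNP no_x; apply: (not_sub i) => z Cz.
  by apply: contrapT => nFz; exact: (no_x z).
have [i0 _ _] := CF _ Cx0.
have card_gt0 : 0 < #|I|%:R :> R by rewrite ltr0n; apply/card_gt0P; exists i0.
have weights1 : \sum_(i : I) #|I|%:R^-1 = 1 :> R.
  by rewrite sumr_const -[LHS]mulr_natr mulVf// gt_eqF.
have Cx i : C (x i) by case: (missed i).
have weight_gt0 : 0 < #|I|%:R^-1 :> R by rewrite invr_gt0.
have weight_ge0 (i : I) := ltW weight_gt0.
have [i _ Fi] := CF _ (convex_set_sum cC Cx weight_ge0 weights1).
by case: (missed i) => _; apply; exact: face_sum Fi _ weight_gt0.
Qed.

Lemma subdivision_eq_face_complex Sigma : subdivision P Sigma ->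
  (forall i, Sigma (cell i)) -> P `<=` \bigcup_i cell i ->
  Sigma = face_complex (range cell).
Proof.
move=> [_ cellP face_closed meetP unionP] Sigma_cell P_cover.
apply/seteqP; split=> C.
  move=> SC; have [polyC C0 _] := cellP _ SC; split=> //.
  have meet_face i := (meetP C (cell i) SC (Sigma_cell i)).1.
  have [|i Ci] := convex_set_face_cover (convex_set_polytope polyC) C0 meet_face.
    move=> x Cx; have [|i _ ix] := P_cover x; last by exists i.
    by rewrite -unionP; exists C.
  exists (cell i); first by exists i.
  have [_] := meetP C (cell i) SC (Sigma_cell i).
  by rewrite (_ : C `&` cell i = C)//; apply/setIidl => x /Ci[].
by move=> [C0 [_ [i _ <-] fC]]; exact: face_closed fC C0.
Qed.

End FaceComplex.

Section Coarsest.
Variables (R : realType) (n : nat) (I : finType) (P : set 'rV[R]_n).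
Variable cell : I -> set 'rV[R]_n.
Implicit Types (D : set 'rV[R]_n) (Sigma : set (set 'rV[R]_n)).

Definition absorbing D := forall i z, D z -> relint (cell i) z -> cell i `<=` D.

Lemma coarsening_absorbing Sigma D : subdivision P Sigma ->
  coarsening Sigma (face_complex (range cell)) -> Sigma D -> absorbing D.
Proof.
move=> [_ _ _ meetP _] coarse SD i z Dz iz.
have [|E SE iE] := coarse (cell i).
  by apply: face_complex_cell; exists z; case: iz.
have [_ fE] := meetP D E SD SE.
have Ez : E z by apply: iE; case: iz.
by move=> x /(face_relint_sub fE iE iz (conj Dz Ez))[].
Qed.

Lemma coarsest_face_complex : P !=set0 ->
  subdivision P (face_complex (range cell)) -> (forall i, cell i !=set0) ->
  (forall i, cell i <> P) ->
  (forall D i, convex D -> D `<=` P ->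
    absorbing D -> cell i `<=` D -> D = cell i \/ D = P) ->
  coarsest_subdivision P (face_complex (range cell)).
Proof.
move=> P0 subdiv cell0 cell_proper growth.
have cellP i : cell i `<=` P.
  case: subdiv => _ _ _ _ <- x ix; exists (cell i) => //.
  exact: face_complex_cell.
have P_cover : P `<=` \bigcup_i cell i.
  by case: (subdiv) => _ _ _ _ <- x [C [_ [_ [i _ <-] /face_sub Ci]] /Ci]; exists i.
have trivialE Sigma :
    subdivision P Sigma -> Sigma P -> Sigma = trivial_subdivision P.
  move=> subS SP; rewrite /trivial_subdivision.
  rewrite (_ : [set P] = range (fun _ : unit => P)).
    by apply: subdivision_eq_face_complex subS _ _ => // x; exists tt.
  by apply/seteqP; split=> [C ->|C [_ _ <-]]; first exists tt.
split=> // [E|Sigma subS coarse nontrivial].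
  have : face_complex (range cell) P.
    by rewrite E; split=> //; exists P => //; exact: face_refl.
  by move=> [_ [_ [i _ <-] /face_sub Pi]]; apply: (cell_proper i); apply/seteqP.
apply: (subdivision_eq_face_complex subS _ P_cover) => i.
have [D SD iD] := coarse _ (face_complex_cell (cell0 i)).
have convexD : convex D.
  by case: subS => _ /(_ D SD)[polyD _ _] _ _ _; exact: convex_set_polytope.
have DP : D `<=` P by case: subS => _ _ _ _ <- x Dx; exists D.
have [<-//|DE] := growth D i convexD DP (coarsening_absorbing subS coarse SD) iD.
by case: nontrivial; apply: trivialE => //; rewrite -DE.
Qed.

End Coarsest.

(** * Sums of coordinates over sets and matroid polytopes *)

Section SetSum.
Variables (R : realType) (n : nat).
Implicit Types (A B S : {set 'I_n}) (x z : 'rV[R]_n).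

Definition set_sum A x := \sum_(l in A) x 0 l.

Fact set_sum_is_scalar A : scalar (set_sum A).
Proof.
move=> t x z; rewrite /set_sum mulr_sumr -big_split.
by apply: eq_bigr => l _; rewrite !mxE.
Qed.

HB.instance Definition _ A :=
  GRing.isLinear.Build R 'rV[R]_n R *%R (set_sum A) (set_sum_is_scalar A).

Lemma set_sum1 l x : set_sum [set l]%SET x = x 0 l.
Proof. exact: big_set1. Qed.

Lemma set_sumT x : set_sum [set: 'I_n]%SET x = \sum_l x 0 l.
Proof. by apply: eq_bigl => l; rewrite inE. Qed.

Lemma set_sum_delta A l : set_sum A 'e_l = (l \in A)%:R.
Proof.
rewrite /set_sum big_mkcond (bigD1 l)//= mxE !eqxx big1 ?addr0.
  by case: (l \in A).
by move=> h /negPf hl; rewrite mxE eqxx hl; case: ifP.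
Qed.

Lemma set_sum_char_vector A S : set_sum A (char_vector R S) = #|S :&: A|%:R.
Proof.
rewrite -sum1_card natr_sum [LHS]big_mkcond [RHS]big_mkcond.
by apply: eq_bigr => l _; rewrite mxE !inE; case: (l \in A); case: (l \in S).
Qed.

Lemma char_vector_itv S l : 0 <= char_vector R S 0 l <= 1.
Proof. by rewrite mxE; case: (l \in S); rewrite ?lexx ?ler01. Qed.

Lemma integral_char_vector x : (forall l, 0 <= x 0 l <= 1) ->
  (forall l, x 0 l \is a Num.int) -> x = char_vector R [set l | x 0 l == 1]%SET.
Proof.
move=> x01 x_int; apply/rowP => l; rewrite mxE inE.
have /intrP[z xE] := x_int l; have := x01 l; rewrite xE.
rewrite -[0]/(0%:~R) -[1]/(1%:~R) !ler_int eqr_int => z01.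
by have [->|->] : z = 0 \/ z = 1 by lia.
Qed.

Lemma char_vector_exchange S l m : l \in S -> m \notin S ->
  char_vector R (m |: S :\ l) = char_vector R S + 'e_m - 'e_l.
Proof.
move=> lS mS; apply/rowP => h; rewrite !mxE !inE !eqxx/=.
have [->|hm] := eqVneq h m.
  rewrite (negPf mS); case: eqVneq => [ml|_]; first by rewrite ml lS in mS.
  by rewrite subr0 add0r.
by have [->|hl] := eqVneq h l; rewrite /= ?lS ?addr0 ?subrr ?subr0.
Qed.

Lemma vertex_hypersimplex S : vertex (hypersimplex R n #|S|) (char_vector R S).
Proof.
apply/faceP; exists (set_sum S), #|S|%:R.
have sumE x : \sum_l x 0 l = set_sum S x + \sum_(l in ~: S) x 0 l.
  by rewrite (bigID (mem S))/=; congr +%R; apply: eq_bigl => l; rewrite inE.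
split=> [x [x01 <-]|].
  by rewrite sumE lerDl sumr_ge0// => l _; case/andP: (x01 l).
apply/seteqP; split=> x.
  move=> ->; rewrite /= set_sum_char_vector finset.setIid; split=> //; split.
    exact: char_vector_itv.
  by rewrite -set_sumT set_sum_char_vector finset.setIT.
move=> [[x01 xS] /= SE]; apply/rowP => l; rewrite mxE.
have /psumr_eq0P in0 : \sum_(l in S) (1 - x 0 l) = 0.
  by rewrite sumrB sumr_const -/(set_sum S x) SE subrr.
have /psumr_eq0P out0 : \sum_(l in ~: S) x 0 l = 0.
  by move: xS; rewrite sumE SE => /eqP; rewrite -subr_eq0 addrAC subrr add0r => /eqP.
have [lS|lS] := boolP (l \in S).
  apply/esym/eqP; rewrite -subr_eq0; apply/eqP/in0 => // h _.
  by rewrite subr_ge0; case/andP: (x01 h).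
by apply: out0; rewrite ?inE// => h _; case/andP: (x01 h).
Qed.

End SetSum.

Section SymmetricExchange.
Variable n : nat.
Implicit Types (B : {set {set 'I_n}}) (X Y : {set 'I_n}).

Definition symmetric_exchange B := forall X Y, X \in B -> Y \in B ->
  forall x, x \in X :\: Y -> exists2 y, y \in Y :\: X &
    (y |: X :\ x \in B) /\ (x |: Y :\ y \in B).

Lemma symmetric_exchange_matroid B : symmetric_exchange B -> B != finset.set0 ->
  exists M : matroid n, bases M = B.
Proof.
move=> exB B0; suff ex X Y : X \in B -> Y \in B -> forall x, x \in X :\: Y ->
  exists2 y, y \in Y :\: X & y |: X :\ x \in B by exists (Matroid B0 ex).
by move=> XB YB x /(exB X Y XB YB)[y yYX []]; exists y.
Qed.

Variable R : realType.

(* Both sets produced by a symmetric exchange lie in [B], and their weights add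
   up to twice the maximum; hence both have maximal weight. *)
Lemma symmetric_exchange_maximizers B (f : {scalar 'rV[R]_n}) (b : R) :
  symmetric_exchange B -> {in B, forall X, f (char_vector R X) <= b} ->
  symmetric_exchange [set X in B | f (char_vector R X) == b]%SET.
Proof.
move=> exB fb X Y; rewrite !inE => /andP[XB /eqP fX] /andP[YB /eqP fY] x xXY.
have [y yYX [X'B Y'B]] := exB X Y XB YB x xXY; exists y => //.
have := fb _ X'B; have := fb _ Y'B; move: xXY yYX.
rewrite !inE X'B Y'B => /andP[xY xX] /andP[yX yY].
rewrite !char_vector_exchange// !linearB !linearD/= fX fY => fY'b fX'b.
by split; apply/eqP; lra.
Qed.

Lemma face_matroid_polytope B (F : set 'rV[R]_n) : symmetric_exchange B ->
  face (convex_hull [set char_vector R X | X in [set` B]]) F -> F !=set0 ->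
  exists M : matroid n, F = matroid_polytope M.
Proof.
move=> exB fF F0; have FE := face_convex_hull fF.
have [f [b [fb FfE]]] := (faceP _ _).1 fF.
have in_hull X : X \in B ->
    convex_hull [set char_vector R X | X in [set` B]] (char_vector R X).
  by move=> XB; apply: sub_convex_hull; exists X.
pose Bmax := [set X in B | f (char_vector R X) == b]%SET.
have Fmax : F = convex_hull [set char_vector R X | X in [set` Bmax]].
  rewrite FE; congr convex_hull; apply/seteqP; split=> x.
    move=> [[X /= XB <-]]; rewrite FfE => -[_ /= fX].
    by exists X; rewrite //= inE XB fX eqxx.
  move=> [X /= + <-]; rewrite inE => /andP[XB /eqP fX]; split; first by exists X.
  by rewrite FfE; split=> //; exact: in_hull.
have exBmax : symmetric_exchange Bmax.
  by apply: symmetric_exchange_maximizers => // X /in_hull/fb.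
have Bmax0 : Bmax != finset.set0.
  case: F0 => x; rewrite Fmax => /convex_hull_nonempty[_ [X /= XB _]].
  by apply/set0Pn; exists X.
have [M ME] := symmetric_exchange_matroid exBmax Bmax0.
by exists M; rewrite /matroid_polytope ME.
Qed.

End SymmetricExchange.

(** * Integrality of laminar polytopes *)

Section TimeToInteger.
Variable R : archiRealFieldType.
Implicit Types a s t : R.

Definition time_to_int a s : R :=
  ((if 0 < s then Num.ceil a else Num.floor a)%:~R - a) / s.

Lemma time_to_int_gt0 a s :
  s != 0 -> a \isn't a Num.int -> 0 < time_to_int a s.
Proof.
rewrite /time_to_int => s0 aZ; case: (ltP 0 s) => [s_gt0|s_le0].
  rewrite divr_gt0// subr_gt0 lt_neqAle ceil_ge andbT.
  by apply: contraNneq aZ => ->.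
have s_lt0 : s < 0 by rewrite lt_neqAle s0.
rewrite ltr_ndivlMr// mul0r subr_lt0 lt_neqAle floor_le andbT.
by apply: contraNneq aZ => <-.
Qed.

Lemma add_time_to_int a s : s != 0 -> a + time_to_int a s * s \is a Num.int.
Proof. by move=> s0; rewrite divfK// addrC subrK. Qed.

Lemma before_time_to_int a s t : s != 0 -> 0 <= t <= time_to_int a s ->
  (Num.floor a)%:~R <= a + t * s <= (Num.ceil a)%:~R.
Proof.
rewrite /time_to_int => s0 /andP[t0]; case: (ltP 0 s) => [s_gt0|s_le0].
  rewrite ler_pdivlMr// => t_le; have := floor_le a.
  by have := mulr_ge0 t0 (ltW s_gt0); lra.
have s_lt0 : s < 0 by rewrite lt_neqAle s0.
rewrite ler_ndivlMr// => t_ge; have := ceil_ge a.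
by have := mulr_ge0_le0 t0 s_le0; lra.
Qed.

End TimeToInteger.

Section IntegralBounds.
Variables (R : realType) (n : nat) (K : finType).
Variables (q : K -> {scalar 'rV[R]_n}) (lo hi : K -> int).
Implicit Types (x v : 'rV[R]_n) (c : K).

Definition bounded_polyhedron : set 'rV[R]_n :=
  [set x | forall c, (lo c)%:~R <= q c x <= (hi c)%:~R].

Definition nonintegral x := [set c | q c x \isn't a Num.int]%SET.

Lemma convex_set_bounded_polyhedron : convex bounded_polyhedron.
Proof.
apply/convex_setP => x z t Kx Kz t01 c.
have [/andP[lx xh] /andP[lz zh]] := (Kx c, Kz c).
have /convex_setP upper := convex_set_halfspace (f := q c) (a := (hi c)%:~R).
have /convex_setP lower := convex_set_halfspace (f := \- q c) (a := - (lo c)%:~R).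
apply/andP; split; last exact: (upper x z t).
by have := lower x z t; rewrite /= !lerN2; apply.
Qed.

Lemma move_to_integer x v c0 : bounded_polyhedron x -> q c0 v != 0 ->
  (forall c, q c x \is a Num.int -> q c v = 0) ->
  exists2 t, 0 < t & bounded_polyhedron (x + t *: v) /\
    (#|nonintegral (x + t *: v)| < #|nonintegral x|)%N.
Proof.
move=> Kx v0 v_int.
pose time c := time_to_int (q c x) (q c v).
have [c v_c time_min] := arg_minP (P := fun c => q c v != 0) time v0.
have qE c' : q c' (x + time c *: v) = q c' x + time c * q c' v.
  by rewrite linearD linearZ.
have x_c : q c x \isn't a Num.int by apply: contra v_c => /v_int->.
have time_gt0 : 0 < time c by exact: time_to_int_gt0.
exists (time c) => //; split.
  move=> c'; rewrite qE; have [->|v_c'] := eqVneq (q c' v) 0.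
    by rewrite mulr0 addr0.
  have /andP[floor_le le_ceil] :
      (Num.floor (q c' x))%:~R <= q c' x + time c * q c' v <= (Num.ceil (q c' x))%:~R.
    by apply: before_time_to_int; rewrite // ltW//= time_min.
  have /andP[lo_le le_hi] := Kx c'; apply/andP; split.
    by apply: le_trans floor_le; rewrite ler_int floor_ge_int.
  by apply: (le_trans le_ceil); rewrite ler_int ceil_le_int.
apply/proper_card/properP; split.
  apply/fintype.subsetP => c'; rewrite !inE qE; apply: contra => x_c'.
  by rewrite (v_int c')// mulr0 addr0.
by exists c; rewrite inE// qE negbK add_time_to_int.
Qed.

Lemma bounded_polyhedron_integral :
  (forall x, bounded_polyhedron x -> nonintegral x != finset.set0 ->
    exists v c, q c v != 0 /\ forall c', q c' x \is a Num.int -> q c' v = 0) ->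
  bounded_polyhedron = convex_hull
    [set x | bounded_polyhedron x /\ forall c, q c x \is a Num.int].
Proof.
move=> direction; apply/seteqP; split; last first.
  by apply: convex_hull_sub => [|x []//]; exact: convex_set_bounded_polyhedron.
move=> x; have [N] := ubnP #|nonintegral x|; elim: N x => // N IH x xN Kx.
have [x_int|x_nonint] := eqVneq (nonintegral x) finset.set0.
  apply: sub_convex_hull; split=> // c; apply: contraT => xc.
  by move/setP: x_int => /(_ c); rewrite !inE xc.
have [v [c [vc v_int]]] := direction x Kx x_nonint.
have [s s0 [Ks xs]] := move_to_integer Kx vc v_int.
have [||t t0 [Kt xt]] := @move_to_integer x (- v) c Kx.
- by rewrite linearN oppr_eq0.
- by move=> c' /v_int vc'; rewrite linearN vc' oppr0.
have -> : x = (t / (s + t)) *: (x + s *: v) + (1 - t / (s + t)) *: (x + t *: - v).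
  by apply/rowP => l; rewrite !mxE; field; rewrite gt_eqF// addr_gt0.
have /convex_setP hullP := @convex_set_convex_hull R n
  [set x | bounded_polyhedron x /\ forall c, q c x \is a Num.int].
apply: hullP; [exact: IH (leq_trans xs xN) Ks|exact: IH (leq_trans xt xN) Kt|].
by rewrite divr_ge0 ?ler_pdivrMr; lra.
Qed.

End IntegralBounds.

Section Laminar.
Variables (R : realType) (n : nat) (K : finType) (A : K -> {set 'I_n}).
Implicit Types (x : 'rV[R]_n) (c : K) (l m : 'I_n).

Definition laminar := forall c c',
  [|| A c \subset A c', A c' \subset A c | [disjoint A c & A c']].

Lemma set_sum_int (S : {set 'I_n}) l x : l \in S ->
  {in S, forall m, m != l -> x 0 m \is a Num.int} ->
  (set_sum S x \is a Num.int) = (x 0 l \is a Num.int).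
Proof.
move=> lS x_int; rewrite /set_sum (bigD1 l)//= rpredDr//.
by apply: rpred_sum => m /andP[mS ml]; exact: x_int.
Qed.

(* A smallest member with an integral sum and a fractional coordinate has two
   fractional coordinates, and no other member with an integral sum separates
   them. *)
Lemma laminar_fractional_pair x c0 l0 : laminar -> A c0 = [set: 'I_n]%SET ->
  set_sum (A c0) x \is a Num.int -> x 0 l0 \isn't a Num.int ->
  exists l m, l != m /\
    forall c, set_sum (A c) x \is a Num.int -> (l \in A c) = (m \in A c).
Proof.
move=> lamA Ac0 x_c0 x_l0.
pose fractional c := (set_sum (A c) x \is a Num.int) &&
  [exists l in A c, x 0 l \isn't a Num.int].
have fractional_c0 : fractional c0.
  by rewrite /fractional x_c0/=; apply/exists_inP; exists l0; rewrite ?Ac0 ?inE.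
have [c /andP[x_c /exists_inP[l lc x_l]] c_min] :=
  arg_minnP (fun c => #|A c|) fractional_c0.
have [m [mc ml x_m]] : exists m, [/\ m \in A c, m != l & x 0 m \isn't a Num.int].
  apply: contrapT => /forallNP unique_l; move: x_c.
  rewrite (set_sum_int lc) ?(negPf x_l)// => m mc ml.
  by apply: contraT => x_m; case: (unique_l m).
have not_separated h h' c' : h \in A c -> x 0 h \isn't a Num.int -> h' \in A c ->
    set_sum (A c') x \is a Num.int -> h \in A c' -> h' \in A c'.
  move=> hc x_h h'c x_c' hc'; have /or3P[cc'|c'c|/pred0P/(_ h)] := lamA c c'.
  - exact: (fintype.subsetP cc').
  - suff /eqP-> : A c' == A c by [].
    rewrite finset.eqEcard c'c c_min// /fractional x_c'.
    by apply/exists_inP; exists h.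
  - by rewrite /= hc hc'.
exists l, m; split=> [|c' x_c']; first by rewrite eq_sym.
by apply/idP/idP; apply: not_separated.
Qed.

Lemma laminar_polyhedron_integral (lo hi : K -> int) c0 :
  laminar -> A c0 = [set: 'I_n]%SET -> lo c0 = hi c0 ->
  (forall l, exists c, A c = [set l]%SET) ->
  let P := bounded_polyhedron (fun c => @set_sum R n (A c)) lo hi in
  P = convex_hull [set x | P x /\ forall c, set_sum (A c) x \is a Num.int].
Proof.
move=> lamA Ac0 lohi singletons P; apply: bounded_polyhedron_integral.
move=> x Px /set0Pn[c1]; rewrite inE /= => x_c1.
have [l0 x_l0] : exists l, x 0 l \isn't a Num.int.
  apply: contrapT => /forallNP x_int; case/negP: x_c1.
  by apply: rpred_sum => l _; apply: contraT => /x_int.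
have x_c0 : set_sum (A c0) x \is a Num.int.
  suff -> : set_sum (A c0) x = (hi c0)%:~R by [].
  by have := Px c0; rewrite /= lohi => /le_anti.
have [l [m [lm not_separated]]] := laminar_fractional_pair lamA Ac0 x_c0 x_l0.
have [c Ac] := singletons l; exists ('e_l - 'e_m), c; split=> /=.
  rewrite linearB/= !set_sum_delta Ac !inE eqxx [m == l]eq_sym (negPf lm).
  by rewrite subr0 oner_eq0.
by move=> c' /not_separated lm'; rewrite linearB/= !set_sum_delta lm' subrr.
Qed.

End Laminar.

(** * Polytopes bounding the sums over the blocks of a partition *)

Section BlockBases.
Variables (n k : nat) (J : finType) (g : 'I_n -> J) (lo hi : J -> nat).
Implicit Types (j : J) (X Y S : {set 'I_n}).

Definition block j : {set 'I_n} := [set l | g l == j]%SET.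

Definition block_bases : {set {set 'I_n}} :=
  [set S : {set 'I_n} | (#|S| == k) &&
    [forall j, lo j <= #|S :&: block j| <= hi j]]%N%SET.

Lemma card_blocks S : #|S| = (\sum_j #|S :&: block j|)%N.
Proof.
rewrite -sum1_card (partition_big g xpredT)//=; apply: eq_bigr => j _.
by rewrite -sum1_card; apply: eq_bigl => l; rewrite !inE.
Qed.

Lemma card_exchange X S x y : x \in X -> y \notin X ->
  (#|(y |: X :\ x) :&: S| + (x \in S) = #|X :&: S| + (y \in S))%N.
Proof.
move=> xX yX; rewrite [#|X :&: S|](cardsD1 x) [#|_ :&: S|](cardsD1 y).
rewrite !inE eqxx xX /=.
have -> : ((y |: X :\ x) :&: S) :\ y = (X :&: S) :\ x.
  apply/setP => l; rewrite !inE; case: eqVneq => [->|_]/=; last by rewrite andbA.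
  by rewrite (negPf yX) andbF.
lia.
Qed.

Lemma block_basis_exchange X x y : X \in block_bases -> x \in X -> y \notin X ->
  (g x != g y -> (lo (g x) < #|X :&: block (g x)|)%N /\
                 (#|X :&: block (g y)| < hi (g y))%N) ->
  y |: X :\ x \in block_bases.
Proof.
rewrite !inE => /andP[/eqP Xk /forallP X_bounds] xX yX slack; apply/andP; split.
  have := card_exchange [set: _]%SET xX yX.
  by rewrite !finset.setIT !inE; lia.
apply/forallP => j; have := card_exchange (block j) xX yX; rewrite !inE.
have := X_bounds j; have [xy|/slack[x_slack y_slack]] := eqVneq (g x) (g y).
  by rewrite xy; lia.
case: eqVneq => [<-|_]; case: eqVneq => [<-|_]; lia.
Qed.

Lemma card_block_lt_setD X Y j :
  (#|X :&: block j| < #|Y :&: block j|)%N -> exists2 y, y \in Y :\: X & g y = j.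
Proof.
move=> lt_j; have /subsetPn[y] : ~~ (Y :&: block j \subset X :&: block j).
  by apply/negP => /subset_leq_card; rewrite leqNgt lt_j.
rewrite !inE => /andP[yY /eqP gy]; rewrite gy eqxx andbT => yX.
by exists y; rewrite ?inE ?yX.
Qed.

(* If [Y :\: X] misses the block of [x], then [X] has more elements than [Y] in
   that block, hence fewer in some other block, and an element [y] of [Y :\: X]
   in the latter can be traded for [x]. *)
Lemma block_bases_symmetric_exchange : symmetric_exchange block_bases.
Proof.
move=> X Y XB YB x; rewrite inE => /andP[xY xX].
have [/exists_inP[y]|/exists_inPn/= no_y] :=
    boolP [exists y in Y :\: X, g y == g x].
  rewrite inE => /andP[yX yY] /eqP gy; exists y; first by rewrite inE yX.
  by split; apply: block_basis_exchange; rewrite // gy eqxx.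
have lt_gx : (#|Y :&: block (g x)| < #|X :&: block (g x)|)%N.
  apply/proper_card/properP; split.
    apply/fintype.subsetP => y; rewrite !inE => /andP[yY gy]; rewrite gy andbT.
    by apply: contraLR gy => yX; apply: no_y; rewrite inE yX.
  by exists x; rewrite !inE ?xX ?eqxx// (negPf xY).
move: (XB); rewrite inE => /andP[/eqP Xk /forallP X_bounds].
move: (YB); rewrite inE => /andP[/eqP Yk /forallP Y_bounds].
have [j lt_j] : exists j, (#|X :&: block j| < #|Y :&: block j|)%N.
  apply/existsP; apply: contraT => /existsPn le_blocks.
  have : (\sum_j #|Y :&: block j| < \sum_j #|X :&: block j|)%N.
    rewrite !(bigD1 (P := xpredT) (g x))//= -addSn leq_add// leq_sum// => j _.
    by rewrite leqNgt.
  by rewrite -!card_blocks Xk Yk ltnn.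
have [y yYX gy] := card_block_lt_setD lt_j; exists y => //.
move: yYX; rewrite inE => /andP[yX yY].
have := X_bounds (g x); have := X_bounds j.
have := Y_bounds (g x); have := Y_bounds j.
by split; apply: block_basis_exchange; rewrite // gy => _; lia.
Qed.

End BlockBases.

Section BlockPolytope.
Variables (R : realType) (n k : nat) (J : finType) (g : 'I_n -> J).
Implicit Types (j : J) (S : {set 'I_n}) (x v : 'rV[R]_n).

Lemma sum_set_sum_block x : \sum_l x 0 l = \sum_j set_sum (block g j) x.
Proof.
rewrite (partition_big g xpredT)//=; apply: eq_bigr => j _.
by apply: eq_bigl => l; rewrite inE.
Qed.

Variables lo hi : J -> nat.

Definition block_polytope : set 'rV[R]_n :=
  [set x | hypersimplex R n k x /\
           forall j, (lo j)%:R <= set_sum (block g j) x <= (hi j)%:R].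

Lemma char_vector_block_polytope S :
  block_polytope (char_vector R S) <-> S \in block_bases k g lo hi.
Proof.
rewrite inE; split=> [[[_ Sk] S_bounds]|/andP[/eqP Sk /forallP S_bounds]].
  move: Sk; rewrite -set_sumT set_sum_char_vector finset.setIT => /eqP.
  rewrite eqr_nat => ->; apply/forallP => j.
  by have := S_bounds j; rewrite set_sum_char_vector !ler_nat.
split=> [|j]; last by rewrite set_sum_char_vector !ler_nat.
split; first exact: char_vector_itv.
by rewrite -set_sumT set_sum_char_vector finset.setIT Sk.
Qed.

Definition block_family (c : option ('I_n + J)) : {set 'I_n} :=
  match c with
  | None => [set: 'I_n]
  | Some (inl l) => [set l]
  | Some (inr j) => block g j
  end%SET.

Lemma laminar_block_family : laminar block_family.
Proof.
have singleton l S : [|| [set l]%SET \subset S, S \subset [set l]%SET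
                       | [disjoint [set l]%SET & S]].
  rewrite finset.sub1set; have [//|lS] := boolP (l \in S).
  by rewrite finset.disjoints1 lS !orbT.
have swap S S' : [|| S \subset S', S' \subset S | [disjoint S & S']] ->
    [|| S' \subset S, S \subset S' | [disjoint S' & S]].
  by rewrite orbCA disjoint_sym.
case=> [[l|j]|] [[m|j']|]; rewrite /= ?finset.subsetT ?orbT//.
- exact: (swap _ _ (singleton m _)).
- have [->|jj'] := eqVneq j j'; first by rewrite subxx.
  suff -> : [disjoint block g j & block g j']%B by rewrite !orbT.
  apply/pred0P => l; rewrite /= !inE; apply/negP => /andP[/eqP gl].
  by rewrite gl (negPf jj').
Qed.

Lemma block_polytope_integral : block_polytope =
  convex_hull [set char_vector R S | S in [set` block_bases k g lo hi]].
Proof.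
pose lower (c : option ('I_n + J)) : int := match c with
  | None => k | Some (inl _) => 0 | Some (inr j) => lo j end.
pose upper (c : option ('I_n + J)) : int := match c with
  | None => k | Some (inl _) => 1 | Some (inr j) => hi j end.
have familyE : block_polytope =
    bounded_polyhedron (fun c => @set_sum R n (block_family c)) lower upper.
  apply/seteqP; split=> [x [[x01 xk] x_bounds] [[l|j]|]|x x_bounds] /=.
  - by rewrite set_sum1.
  - exact: x_bounds.
  - by rewrite set_sumT xk lexx.
  - split=> [|j]; last exact: (x_bounds (Some (inr j))).
    split=> [l|]; first by have := x_bounds (Some (inl l)); rewrite /= set_sum1.
    by apply/esym/le_anti; rewrite -set_sumT; exact: (x_bounds None).
rewrite {1}familyE.
rewrite (laminar_polyhedron_integral R (@laminar_block_family) (c0 := None))//.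
  rewrite -familyE; congr convex_hull.
  apply/seteqP; split=> [x [Px x_int]|_ [S SB <-]].
    have x_char : x = char_vector R [set l | x 0 l == 1]%SET.
      apply: integral_char_vector => l; first by case: Px => -[].
      by have := x_int (Some (inl l)); rewrite /= set_sum1.
    exists [set l | x 0 l == 1]%SET => //=.
    by apply/char_vector_block_polytope; rewrite -x_char.
  split; first exact/char_vector_block_polytope.
  by move=> c; rewrite /= set_sum_char_vector natr_int.
by move=> l; exists (Some (inl l)).
Qed.

Lemma polytope_block_polytope : polytope block_polytope.
Proof.
rewrite block_polytope_integral.
by exists [set char_vector R S | S in [set` block_bases k g lo hi]] => //;
  exact/finite_image/finite_finset.
Qed.

Lemma vertex_block_polytope v :
  vertex block_polytope v -> vertex (hypersimplex R n k) v.
Proof.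
rewrite block_polytope_integral => /vertex_convex_hull[S /= + <-].
by rewrite inE => /andP[/eqP <- _]; exact: vertex_hypersimplex.
Qed.

Lemma face_block_polytope F : face block_polytope F -> F !=set0 ->
  exists M : matroid n, F = matroid_polytope M.
Proof.
rewrite block_polytope_integral.
exact/face_matroid_polytope/block_bases_symmetric_exchange.
Qed.

End BlockPolytope.

Section ProductHypersimplex.
Variables (R : realType) (n : nat).
Implicit Types (l : 'I_n) (x z v : 'rV[R]_n).

Definition open_cube : set 'rV[R]_n := [set x | forall l, 0 < x 0 l < 1].

Lemma open_cube_midpoint x z : (forall l, 0 <= x 0 l <= 1) ->
  open_cube z -> open_cube (midpoint x z).
Proof.
move=> x01 z01 l; have /andP[x0 x1] := x01 l; have /andP[z0 z1] := z01 l.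
by rewrite !mxE; lra.
Qed.

Definition product_hypersimplex (J : finType) (g : 'I_n -> J) (mu : J -> nat) :
    set 'rV[R]_n :=
  [set x : 'rV[R]_n | forall l, 0 <= x 0 l <= 1] `&`
  [set x | forall j, set_sum (block g j) x = (mu j)%:R].

Lemma block_unit : block (fun _ : 'I_n => tt) tt = [set: 'I_n]%SET.
Proof. by apply/setP => l; rewrite !inE. Qed.

Lemma hypersimplex_product k :
  hypersimplex R n k = product_hypersimplex (fun=> tt) (fun=> k).
Proof.
apply/seteqP; split=> x [x01 xk]; split=> //.
  by case; rewrite block_unit set_sumT.
by rewrite -set_sumT -(xk tt) block_unit.
Qed.

Section Blocks.
Variables (J : finType) (g : 'I_n -> J) (mu : J -> nat).

Lemma feasible_direction_product_hypersimplex z v :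
  open_cube z -> product_hypersimplex g mu z ->
  (forall j, set_sum (block g j) v = 0) ->
  feasible_direction (product_hypersimplex g mu) z v.
Proof.
move=> z01 [_ z_mu] v0; apply: feasible_directionI.
  have cubeE : [set x : 'rV[R]_n | forall l, 0 <= x 0 l <= 1] =
      [set x : 'rV[R]_n | forall l, ([set y | (\- set_sum [set l]%SET) y <= 0] `&`
                                     [set y | set_sum [set l]%SET y <= 1]) x].
    apply/seteqP; split=> x x01 l; have := x01 l; rewrite /= set_sum1 oppr_le0.
      by move/andP.
    by case=> -> ->.
  rewrite cubeE; apply: feasible_direction_forall => l; have /andP[z0 z1] := z01 l.
  by apply: feasible_directionI; apply: feasible_direction_halfspace;
    rewrite /= set_sum1 ?oppr_lt0.
apply: feasible_direction_forall => j.
exact: feasible_direction_level (z_mu j) (v0 j).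
Qed.

Definition block_indicator_mx : 'M[R]_(n, #|J|) :=
  \matrix_(l, c) (g l == enum_val c)%:R.

Lemma mulmx_block_indicator x c :
  (x *m block_indicator_mx) 0 c = set_sum (block g (enum_val c)) x.
Proof.
rewrite mxE [RHS]big_mkcond; apply: eq_bigr => l _; rewrite mxE inE.
by case: ifP; rewrite ?mulr1 ?mulr0.
Qed.

Lemma mxrank_block_indicator :
  (forall j, 0 < #|block g j|)%N -> \rank block_indicator_mx = #|J|.
Proof.
move=> block_gt0; rewrite -mxrank_tr; apply/eqP/row_freeP.
exists (\matrix_(l, c) ((g l == enum_val c)%:R / #|block g (enum_val c)|%:R)).
apply/matrixP => c c'; rewrite !mxE.
pose y := \row_l ((g l == enum_val c')%:R / #|block g (enum_val c')|%:R) : 'rV[R]_n.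
transitivity (set_sum (block g (enum_val c)) y).
  by rewrite -mulmx_block_indicator mxE; apply: eq_bigr => l _; rewrite !mxE mulrC.
rewrite /set_sum (eq_bigr (fun=> (c == c')%:R / #|block g (enum_val c')|%:R)).
  rewrite sumr_const -[LHS]mulr_natr; case: eqVneq => [->|_]; last by rewrite !mul0r.
  by rewrite divfK// pnatr_eq0 -lt0n.
by move=> l; rewrite inE mxE => /eqP->; rewrite (inj_eq enum_val_inj).
Qed.

Lemma has_dim_product_hypersimplex z : (forall j, 0 < #|block g j|)%N ->
  open_cube z -> product_hypersimplex g mu z ->
  has_dim (product_hypersimplex g mu) (n - #|J|).
Proof.
move=> block_gt0 z01 zP; rewrite -(mxrank_block_indicator block_gt0).
apply: (has_dim_kernel zP) => [x [_ x_mu]|v v0].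
  by apply/rowP => c; rewrite !mulmx_block_indicator x_mu zP.2.
apply: feasible_direction_product_hypersimplex => // j.
by rewrite -[j]enum_rankK -mulmx_block_indicator v0 mxE.
Qed.

End Blocks.

Section Hypersimplex.
Variable k : nat.

Lemma convex_set_hypersimplex : convex (hypersimplex R n k).
Proof.
apply/convex_setP => x z t [x01 xk] [z01 zk] /andP[t0 t1]; split=> [l|].
  have /andP[x0 x1] := x01 l; have /andP[z0 z1] := z01 l; rewrite !mxE.
  have t'0 : 0 <= 1 - t by lra.
  have := ler_wpM2l t0 x1; have := ler_wpM2l t'0 z1.
  have := mulr_ge0 t0 x0; have := mulr_ge0 t'0 z0; lra.
by rewrite -set_sumT linearD !linearZ/= !set_sumT xk zk; ring.
Qed.

Lemma feasible_direction_hypersimplex z v :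
  open_cube z -> hypersimplex R n k z -> \sum_l v 0 l = 0 ->
  feasible_direction (hypersimplex R n k) z v.
Proof.
rewrite hypersimplex_product => z01 zP v0.
apply: feasible_direction_product_hypersimplex => // -[].
by rewrite block_unit set_sumT.
Qed.

Lemma relint_hypersimplex z :
  open_cube z -> hypersimplex R n k z -> relint (hypersimplex R n k) z.
Proof.
move=> z01 zP; split=> // x [_ xk]; apply: feasible_direction_hypersimplex => //.
by rewrite -set_sumT linearB/= !set_sumT zP.2 xk subrr.
Qed.

Lemma has_dim_hypersimplex z : (0 < n)%N ->
  open_cube z -> hypersimplex R n k z -> has_dim (hypersimplex R n k) n.-1.
Proof.
move=> n0; rewrite hypersimplex_product -subn1 -card_unit.
apply: has_dim_product_hypersimplex => -[].
by apply/card_gt0P; exists (Ordinal n0); rewrite inE.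
Qed.

End Hypersimplex.

End ProductHypersimplex.

Section BlockPoint.
Variables (R : realType) (n k : nat) (J : finType) (g : 'I_n -> J) (mu : J -> nat).
Hypothesis mu_bounds : forall j, (0 < mu j < #|block g j|)%N.
Implicit Types (j : J) (x z : 'rV[R]_n) (d : J -> R).

Definition excess j x : R := set_sum (block g j) x - (mu j)%:R.

Lemma excess_eq0 j x : excess j x = 0 <-> set_sum (block g j) x = (mu j)%:R.
Proof. by rewrite /excess; split=> [/eqP|->]; rewrite ?subrr// subr_eq0 => /eqP. Qed.

Lemma excess_midpoint j x z :
  excess j (midpoint x z) = (excess j x + excess j z) / 2.
Proof. by rewrite /excess /midpoint linearZ linearD/=; field. Qed.

Definition block_point d : 'rV[R]_n :=
  \row_l (((mu (g l))%:R + d (g l)) / #|block g (g l)|%:R).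

Lemma excess_block_point d j : excess j (block_point d) = d j.
Proof.
have block_neq0 : #|block g j|%:R != 0 :> R.
  by rewrite pnatr_eq0 -lt0n; case/andP: (mu_bounds j) => _; exact: leq_ltn_trans.
rewrite /excess /set_sum (eq_bigr (fun=> ((mu j)%:R + d j) / #|block g j|%:R)).
  by rewrite sumr_const -[_ *+ _]mulr_natr divfK// addrC addKr.
by move=> l; rewrite inE mxE => /eqP->.
Qed.

Lemma open_cube_block_point d : (forall j, `|d j| < 1) -> open_cube (block_point d).
Proof.
move=> d_lt1 l; rewrite mxE; set j := g l.
have /andP[mu_gt0 mu_lt] := mu_bounds j.
have := d_lt1 j; rewrite ltr_norml => /andP[d_gt d_lt].
have mu_ge1 : 1 <= (mu j)%:R :> R by rewrite ler1n.
have muS_le : (mu j)%:R + 1 <= #|block g j|%:R :> R by rewrite natr1 ler_nat.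
have block_gt0 : 0 < #|block g j|%:R :> R by lra.
by rewrite divr_gt0 ?ltr_pdivrMr//; lra.
Qed.

Lemma product_hypersimplex_center :
  product_hypersimplex g mu (block_point (fun=> 0)).
Proof.
split=> [l|j].
  suff /(_ l)/andP[/ltW-> /ltW->] : open_cube (block_point (fun=> 0)) by [].
  by apply: open_cube_block_point => j; rewrite normr0.
by apply/excess_eq0; rewrite excess_block_point.
Qed.

Hypothesis sum_mu : (\sum_j mu j)%N = k.

Lemma sum_excess x : \sum_l x 0 l = k%:R <-> \sum_j excess j x = 0.
Proof.
rewrite sumrB -sum_set_sum_block -natr_sum sum_mu.
by split=> [->|/eqP]; rewrite ?subrr// subr_eq0 => /eqP.
Qed.

Lemma hypersimplex_block_point d :
  (forall j, `|d j| < 1) -> \sum_j d j = 0 -> hypersimplex R n k (block_point d).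
Proof.
move=> d_lt1 d0; split=> [l|].
  by have /andP[/ltW-> /ltW->] := open_cube_block_point d_lt1 l.
by apply/sum_excess; under eq_bigr do rewrite excess_block_point.
Qed.

End BlockPoint.

(** * The three-split *)

Section CyclicIndices.
Implicit Types i j : 'I_3.

Lemma ord3_cycle i j : [\/ j = i, j = i + 1 | j = i + 2].
Proof.
case: i j => [[|[|[|//]]] i3] [[|[|[|//]]] j3];
  do [by apply: Or31; apply/val_inj | by apply: Or32; apply/val_inj |
      by apply: Or33; apply/val_inj].
Qed.

Lemma ord3D i : ((i + 1 + 1 = i + 2) * (i + 1 + 2 = i) *
                 (i + 2 + 1 = i) * (i + 2 + 2 = i + 1)).
Proof. by case: i => [[|[|[|//]]] i3]; do !split; apply/val_inj. Qed.

Lemma ord3_neq i :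
  ((i == i + 1) = false) * ((i == i + 2) = false) * ((i + 1 == i) = false) *
  ((i + 2 == i) = false) * ((i + 1 == i + 2) = false) * ((i + 2 == i + 1) = false).
Proof. by case: i => [[|[|[|//]]] i3]. Qed.

Lemma sum_ord3 (V : nmodType) (f : 'I_3 -> V) i :
  \sum_j f j = f i + f (i + 1) + f (i + 2).
Proof.
rewrite (bigD1 i)//= (bigD1 (i + 1)) ?ord3_neq//= (bigD1 (i + 2)) ?ord3_neq//=.
rewrite big1 ?addr0; first exact: addrA.
by move=> j; case: (ord3_cycle i j) => ->; rewrite eqxx ?andbF.
Qed.

End CyclicIndices.

Definition sector (R : realType) (n k : nat) (A B : {set 'I_n}) (a b : nat) :
    set 'rV[R]_n :=
  [set x | [/\ hypersimplex R n k x, set_sum A x <= a%:R & b%:R <= set_sum B x]].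

Section ThreeSplit.
Variables (R : realType) (n k : nat) (g : 'I_n -> 'I_3) (mu : 'I_3 -> nat).
Hypothesis sum_mu : (\sum_j mu j)%N = k.
Hypothesis mu_bounds : forall j, (0 < mu j < #|block g j|)%N.
Implicit Types (i j : 'I_3) (x z : 'rV[R]_n) (D : set 'rV[R]_n).

Local Notation Delta := (hypersimplex R n k).
Local Notation y := (excess g mu).

Definition cell i : set 'rV[R]_n :=
  sector k (block g (i + 2)) (block g (i + 1)) (mu (i + 2)) (mu (i + 1)).

Lemma cellP i x : cell i x <-> [/\ Delta x, y (i + 2) x <= 0 & 0 <= y (i + 1) x].
Proof. by rewrite subr_le0 subr_ge0. Qed.

Lemma cell_sub i : cell i `<=` Delta.
Proof. by move=> x []. Qed.

Lemma sum_excess3 i x : Delta x -> y i x + y (i + 1) x + y (i + 2) x = 0.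
Proof. by case=> _ /(sum_excess g sum_mu); rewrite (sum_ord3 _ i). Qed.

Lemma cell_cover i x : Delta x -> [\/ cell i x, cell (i + 1) x | cell (i + 2) x].
Proof.
move=> Dx; have sum0 := sum_excess3 i Dx.
have [y2|y2] := leP (y (i + 2) x) 0; last first.
  have [y0|y0] := leP (y i x) 0.
    by apply: Or32; apply/cellP; rewrite !ord3D; split=> //; exact: ltW.
  by apply: Or33; apply/cellP; rewrite !ord3D; split=> //; lra.
have [y1|y1] := leP 0 (y (i + 1) x); first by apply: Or31; apply/cellP.
by apply: Or33; apply/cellP; rewrite !ord3D; split=> //; lra.
Qed.

Lemma cell_block_polytope i : cell i = block_polytope k g
  (fun j => if j == i + 1 then mu j else 0%N)
  (fun j => if j == i + 2 then mu j else k).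
Proof.
apply/seteqP; split=> x.
  move=> [[x01 xk] upper lower]; split=> // j.
  have sum_ge0 A : 0 <= set_sum A x by apply: sumr_ge0 => l _; case/andP: (x01 l).
  have sum_le A : set_sum A x <= k%:R.
    rewrite -xk /set_sum [leRHS](bigID (mem A))/= lerDl.
    by apply: sumr_ge0 => l _; case/andP: (x01 l).
  have [->|->|->] := ord3_cycle i j;
    by rewrite ?eqxx !ord3_neq ?upper ?lower ?sum_ge0 ?sum_le.
move=> [Dx x_bounds]; split=> //.
  by have /andP[_] := x_bounds (i + 2); rewrite eqxx.
by have /andP[] := x_bounds (i + 1); rewrite eqxx.
Qed.

Lemma cell_meet_succ i :
  cell i `&` cell (i + 1) = cell i `&` [set x | y (i + 2) x = 0].
Proof.
apply/seteqP; split=> x [ix]; have [Dx y2 y1] := (cellP i x).1 ix.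
  move=> /cellP[_ _]; rewrite ord3D => y2_ge0; split=> //=.
  by apply/le_anti; rewrite y2.
move=> /= y2E; split=> //; apply/cellP; rewrite !ord3D y2E; split=> //.
by have := sum_excess3 i Dx; rewrite y2E; lra.
Qed.

Lemma cell_meet_pred i :
  cell i `&` cell (i + 2) = cell i `&` [set x | y (i + 1) x = 0].
Proof.
apply/seteqP; split=> x [ix]; have [Dx y2 y1] := (cellP i x).1 ix.
  move=> /cellP[_]; rewrite ord3D => y1_le0 _; split=> //=.
  by apply/le_anti; rewrite y1_le0.
move=> /= y1E; split=> //; apply/cellP; rewrite !ord3D y1E; split=> //.
by have := sum_excess3 i Dx; rewrite y1E; lra.
Qed.

Lemma face_cell_meet i j : face (cell i) (cell i `&` cell j).
Proof.
have [->|->|->] := ord3_cycle i j.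
- by rewrite setIid; exact: face_refl.
- rewrite cell_meet_succ; apply/faceP.
  exists (set_sum (block g (i + 2))), (mu (i + 2))%:R; split=> [x []//|].
  by congr (_ `&` _); apply/seteqP; split=> x /excess_eq0.
- rewrite cell_meet_pred; apply/faceP.
  exists (\- set_sum (block g (i + 1))), (- (mu (i + 1))%:R).
  split=> [x [_ _]|]; first by rewrite /= lerN2.
  congr (_ `&` _); apply/seteqP; split=> x /=.
    by move=> /excess_eq0 ->.
  by move=> /oppr_inj/excess_eq0.
Qed.

Lemma relint_cell i x : open_cube x -> Delta x ->
  y (i + 2) x < 0 -> 0 < y (i + 1) x -> relint (cell i) x.
Proof.
move=> x01 Dx; rewrite subr_lt0 subr_gt0 => upper lower.
split=> [|z [Dz _ _]]; first by split=> //; exact: ltW.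
have -> : cell i = Delta `&`
    ([set x | set_sum (block g (i + 2)) x <= (mu (i + 2))%:R] `&`
     [set x | (\- set_sum (block g (i + 1))) x <= - (mu (i + 1))%:R]).
  apply/seteqP; split=> t; first by case; rewrite /= lerN2.
  by move=> [Dt []]; rewrite /= lerN2.
apply: feasible_directionI; first exact: (relint_hypersimplex x01 Dx).2.
apply: feasible_directionI; apply: feasible_direction_halfspace => //=.
by rewrite ltrN2.
Qed.

(* A point in the relative interior of the common facet of the cells [i] and
   [i + 1]. *)
Definition wall_point i : 'rV[R]_n :=
  block_point g mu (fun j => ((j == i + 1)%:R - (j == i)%:R) / 2).

Lemma wall_offset_lt1 i j : `|((j == i + 1)%:R - (j == i)%:R) / 2 : R| < 1.
Proof. by rewrite ltr_norml; case: eqP => _; case: eqP => _ /=; lra. Qed.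

Lemma open_cube_wall_point i : open_cube (wall_point i).
Proof. by apply: open_cube_block_point => // j; exact: wall_offset_lt1. Qed.

Lemma hypersimplex_wall_point i : Delta (wall_point i).
Proof.
apply: hypersimplex_block_point => // [j|]; first exact: wall_offset_lt1.
by rewrite (sum_ord3 _ i) !eqxx !ord3_neq /=; lra.
Qed.

Lemma excess_wall_point i : (y i (wall_point i) = - 2^-1) *
  (y (i + 1) (wall_point i) = 2^-1) * (y (i + 2) (wall_point i) = 0).
Proof. by do !split; rewrite excess_block_point// ?eqxx !ord3_neq /=; lra. Qed.

Lemma wall_point_cell i : cell i (wall_point i).
Proof.
apply/cellP; rewrite !excess_wall_point; split=> //.
exact: hypersimplex_wall_point.
Qed.

Lemma wall_point_cell_succ i : cell (i + 1) (wall_point i).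
Proof.
apply/cellP; rewrite !ord3D !excess_wall_point.
by split=> //; exact: hypersimplex_wall_point.
Qed.

Lemma relint_cell_midpoint_wall i j x : Delta x ->
  y (j + 2) x + y (j + 2) (wall_point i) < 0 ->
  0 < y (j + 1) x + y (j + 1) (wall_point i) ->
  relint (cell j) (midpoint x (wall_point i)).
Proof.
move=> Dx y2 y1; have Dw := hypersimplex_wall_point i.
apply: relint_cell; rewrite ?excess_midpoint ?ltr_pdivrMr ?divr_gt0 ?mul0r//.
  by apply: open_cube_midpoint (open_cube_wall_point i); case: Dx.
by apply: convex_set_midpoint; first exact: convex_set_hypersimplex.
Qed.

Lemma relint_cell_mid_walls i :
  relint (cell i) (midpoint (wall_point i) (wall_point (i + 2))).
Proof.
have := excess_wall_point (i + 2); rewrite !ord3D => excess_wall.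
apply: relint_cell_midpoint_wall; first exact: hypersimplex_wall_point.
- by rewrite excess_wall_point excess_wall; lra.
- by rewrite excess_wall_point excess_wall; lra.
Qed.

Lemma cell_nonempty i : cell i !=set0.
Proof. by exists (wall_point i); exact: wall_point_cell. Qed.

Lemma cell_subset_eq i j : cell i `<=` cell j -> i = j.
Proof.
have := excess_wall_point (i + 2); rewrite !ord3D => excess_wall.
have [mid_cell _] := relint_cell_mid_walls i.
move=> /(_ _ mid_cell)/cellP[_]; rewrite !excess_midpoint.
have [->//|->|->] := ord3_cycle i j; rewrite !ord3D !excess_wall_point !excess_wall.
- by move=> _ ?; exfalso; lra.
- by move=> ?; exfalso; lra.
Qed.

Section AbsorbingSet.
Variable D : set 'rV[R]_n.
Hypothesis convexD : convex D.
Hypothesis sub_Delta : D `<=` Delta.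
Hypothesis absorbingD : absorbing cell D.

Lemma absorb_succ i x :
  cell i `<=` D -> D x -> y i x <= 0 -> 0 < y (i + 2) x -> cell (i + 1) `<=` D.
Proof.
move=> iD Dx y0 y2; apply: (absorbingD (z := midpoint x (wall_point i))).
  exact: convex_set_midpoint convexD Dx (iD _ (wall_point_cell i)).
apply: relint_cell_midpoint_wall; first exact: sub_Delta.
  by rewrite !ord3D excess_wall_point; lra.
by rewrite !ord3D excess_wall_point; lra.
Qed.

Lemma absorb_pred i x :
  cell i `<=` D -> D x -> y (i + 1) x < 0 -> 0 <= y i x -> cell (i + 2) `<=` D.
Proof.
move=> iD Dx y1 y0; have := excess_wall_point (i + 2); rewrite !ord3D => excess_wall.
apply: (absorbingD (z := midpoint x (wall_point (i + 2)))).
  apply: convex_set_midpoint => //; apply: iD.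
  by have := wall_point_cell_succ (i + 2); rewrite !ord3D.
apply: relint_cell_midpoint_wall; first exact: sub_Delta.
  by rewrite !ord3D excess_wall; lra.
by rewrite !ord3D excess_wall; lra.
Qed.

Lemma absorb_third i : cell (i + 1) `<=` D -> cell (i + 2) `<=` D -> cell i `<=` D.
Proof.
move=> D1 D2; apply: absorbingD (relint_cell_mid_walls i).
apply: convex_set_midpoint => //.
  exact/D1/wall_point_cell_succ.
exact/D2/wall_point_cell.
Qed.

Lemma absorbing_cell i : cell i `<=` D -> D = cell i \/ D = Delta.
Proof.
move=> iD; have [Di|] := pselect (D `<=` cell i); first by left; apply/seteqP.
move=> /existsNP[x /not_implyP[Dx not_ix]]; right.
have Deltax := sub_Delta Dx; have sum0 := sum_excess3 i Deltax.
have [D1 D2] : cell (i + 1) `<=` D /\ cell (i + 2) `<=` D.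
  have [y0|y0] := leP (y i x) 0.
    have [y2|y2] := leP (y (i + 2) x) 0.
      by case: not_ix; apply/cellP; split=> //; lra.
    have D1 := absorb_succ iD Dx y0 y2; split=> //.
    by apply: absorb_third; rewrite !ord3D.
  have [y1|y1] := leP 0 (y (i + 1) x).
    by case: not_ix; apply/cellP; split=> //; lra.
  have D2 := absorb_pred iD Dx y1 (ltW y0); split=> //.
  by apply: absorb_third; rewrite !ord3D.
apply/seteqP; split=> // z /(cell_cover i).
by case=> [/iD|/D1|/D2].
Qed.

End AbsorbingSet.

Lemma hypersimplex_center : Delta (block_point g mu (fun=> 0)).
Proof. by apply: hypersimplex_block_point => // [j|]; rewrite ?normr0// big1. Qed.

Lemma open_cube_center : open_cube (block_point g mu (fun=> 0) : 'rV[R]_n).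
Proof. by apply: open_cube_block_point => // j; rewrite normr0. Qed.

Lemma cell_neq_hypersimplex i : cell i <> Delta.
Proof.
move=> iE; have := @cell_subset_eq (i + 1) i; rewrite iE => /(_ (@cell_sub _)).
by move/eqP; rewrite ord3_neq.
Qed.

Lemma subdivision_cells : subdivision Delta (face_complex (range cell)).
Proof.
apply: subdivision_face_complex.
- by move=> i; rewrite cell_block_polytope; exact: polytope_block_polytope.
- by move=> i v; rewrite cell_block_polytope; exact: vertex_block_polytope.
- exact: face_cell_meet.
- apply/seteqP; split=> x; first by case=> i _ /cell_sub.
  by move=> /(cell_cover 0)[]; [exists 0|exists (0 + 1)|exists (0 + 2)].
Qed.

Lemma maximal_cells_cells : maximal_cells (face_complex (range cell)) = range cell.
Proof.
by apply: maximal_cells_face_complex; [exact: cell_nonempty|exact: cell_subset_eq].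
Qed.

Lemma coarsest_cells : coarsest_subdivision Delta (face_complex (range cell)).
Proof.
apply: coarsest_face_complex.
- by exists (block_point g mu (fun=> 0)); exact: hypersimplex_center.
- exact: subdivision_cells.
- exact: cell_nonempty.
- exact: cell_neq_hypersimplex.
- by move=> D i convexD sub_Delta absorbingD; exact: absorbing_cell.
Qed.

Lemma product_hypersimplex_interior_cell :
  interior_cell Delta (face_complex (range cell)) (product_hypersimplex g mu).
Proof.
have center_core := product_hypersimplex_center R mu_bounds.
split; last first.
  move=> /(_ _ center_core).
  exact/relint_not_boundary/relint_hypersimplex/hypersimplex_center/open_cube_center.
split; first by exists (block_point g mu (fun=> 0)).
exists (cell 0); first by exists 0.
apply/faceP; exists (set_sum (block g (0 + 2)) \- set_sum (block g (0 + 1))).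
exists ((mu (0 + 2))%:R - (mu (0 + 1))%:R); split=> [x [_ upper lower]|].
  by rewrite /= lerB.
apply/seteqP; split=> x.
  move=> [x01 x_mu]; split; last by rewrite /= !x_mu.
  split; rewrite ?x_mu//; split=> //; apply/(sum_excess g sum_mu).
  by apply: big1 => j _; apply/excess_eq0.
move=> [[Dx upper lower] /= xE]; split=> [|j]; first by case: Dx.
have := sum_excess3 0 Dx; rewrite /excess => sum0.
by have [->|->|->] := ord3_cycle 0 j; lra.
Qed.

Lemma has_codim_product_hypersimplex :
  has_codim Delta (product_hypersimplex g mu) 2.
Proof.
have block_gt0 j : (0 < #|block g j|)%N.
  by case/andP: (mu_bounds j) => _; exact: leq_ltn_trans.
have n_ge3 : (2 < n)%N.
  have := rank_leq_row (block_indicator_mx R g).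
  by rewrite mxrank_block_indicator// card_ord.
exists (n - 3)%N.
  have := has_dim_product_hypersimplex block_gt0 open_cube_center
    (product_hypersimplex_center R mu_bounds).
  by rewrite card_ord.
have -> : (n - 3 + 2 = n.-1)%N by lia.
apply: has_dim_hypersimplex open_cube_center hypersimplex_center.
exact: leq_trans n_ge3.
Qed.

Lemma card_range_cell : (range cell #= `I_3)%card.
Proof.
have -> : range cell = (cell \o inord) @` `I_3.
  apply/seteqP; split=> C; last by move=> [i _ <-]; exists (inord i).
  by move=> [i _ <-]; exists (i : nat) => /=; rewrite ?inord_val.
apply: inj_card_eq => i j; rewrite !inE /= => i3 j3 ijE.
have /(congr1 val) : inord i = inord j :> 'I_3 by apply: cell_subset_eq; rewrite ijE.
by rewrite /= !inordK.
Qed.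

Lemma three_split_cells : three_split Delta (face_complex (range cell)).
Proof.
split; first exact: coarsest_cells.
  by rewrite maximal_cells_cells; exact: card_range_cell.
exists (product_hypersimplex g mu); first exact: product_hypersimplex_interior_cell.
exact: has_codim_product_hypersimplex.
Qed.

Lemma matroid_subdivision_cells :
  matroid_subdivision Delta (face_complex (range cell)).
Proof.
split; first exact: subdivision_cells.
move=> C [C0 [_ [i _ <-]]]; rewrite cell_block_polytope => fC.
exact: face_block_polytope fC C0.
Qed.

End ThreeSplit.

Section CyclicSectors.
Variables (R : realType) (n : nat) (A1 A2 A3 : {set 'I_n}) (mu1 mu2 mu3 : nat).
Hypothesis A12 : A1 :&: A2 = finset.set0.
Hypothesis A13 : A1 :&: A3 = finset.set0.
Hypothesis A23 : A2 :&: A3 = finset.set0.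
Hypothesis coverA : A1 :|: A2 :|: A3 = [set: 'I_n]%SET.
Hypothesis mu1_bounds : (1 <= mu1 <= #|A1| - 1)%N.
Hypothesis mu2_bounds : (1 <= mu2 <= #|A2| - 1)%N.
Hypothesis mu3_bounds : (1 <= mu3 <= #|A3| - 1)%N.

Local Notation k := (mu1 + mu2 + mu3)%N.

Definition cyclic_sectors : set (set 'rV[R]_n) :=
  [set sector k A3 A2 mu3 mu2; sector k A1 A3 mu1 mu3; sector k A2 A1 mu2 mu1].

Definition part_index l : 'I_3 := if l \in A1 then 0 else if l \in A2 then 1 else 2.

Definition part_mu (j : 'I_3) := nth 0%N [:: mu1; mu2; mu3] j.

Local Notation cells := (cell (R := R) k part_index part_mu).

Lemma block_part_index :
  [/\ block part_index 0 = A1, block part_index 1 = A2 & block part_index 2 = A3].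
Proof.
have part_indexE l : [/\ (part_index l == 0) = (l \in A1),
    (part_index l == 1) = (l \in A2) & (part_index l == 2) = (l \in A3)].
  move/setP/(_ l): A12; move/setP/(_ l): A13; move/setP/(_ l): A23.
  move/setP/(_ l): coverA; rewrite !inE /part_index.
  by case: (l \in A1); case: (l \in A2); case: (l \in A3).
by split; apply/setP => l; rewrite inE; have [] := part_indexE l.
Qed.

Lemma range_cells : range cells = cyclic_sectors.
Proof.
have [block0 block1 block2] := block_part_index.
have cellE i j h A B : i + 2 = j -> i + 1 = h -> block part_index j = A ->
    block part_index h = B -> cells i = sector k A B (part_mu j) (part_mu h).
  by move=> <- <- <- <-.
have cell0 : cells 0 = sector k A3 A2 mu3 mu2.
  by apply: (cellE _ 2 1) => //; apply/val_inj.
have cell1 : cells 1 = sector k A1 A3 mu1 mu3.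
  by apply: (cellE _ 0 2) => //; apply/val_inj.
have cell2 : cells 2 = sector k A2 A1 mu2 mu1.
  by apply: (cellE _ 1 0) => //; apply/val_inj.
rewrite /cyclic_sectors -cell0 -cell1 -cell2; apply/seteqP; split=> C.
  move=> [j _ <-]; have [->|->|->] := ord3_cycle 0 j; rewrite ?add0r.
  - by left; left.
  - by left; right.
  - by right.
by move=> [[->|->]|->]; [exists 0|exists 1|exists 2].
Qed.

Lemma three_split_cyclic_sectors :
  [/\ maximal_cells (face_complex cyclic_sectors) = cyclic_sectors,
      three_split (hypersimplex R n k) (face_complex cyclic_sectors)
    & matroid_subdivision (hypersimplex R n k) (face_complex cyclic_sectors)].
Proof.
have sum_mu : (\sum_j part_mu j)%N = k by rewrite !big_ord_recr big_ord0.
have mu_bounds j : (0 < part_mu j < #|block part_index j|)%N.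
  have [block0 block1 block2] := block_part_index.
  have [->|->|->] := ord3_cycle 0 j; rewrite ?add0r.
  - by rewrite block0 -[part_mu 0]/mu1; lia.
  - by rewrite block1 -[part_mu 1]/mu2; lia.
  - by rewrite block2 -[part_mu 2]/mu3; lia.
rewrite -range_cells; split; first exact: maximal_cells_cells.
  exact: three_split_cells.
exact: matroid_subdivision_cells.
Qed.

End CyclicSectors.

Theorem theorem6p5 (R : realType) (n k : nat) (hkn : (1 <= k < n)%N)
  (A1 A2 A3 : {set 'I_n})
  (hA12 : A1 :&: A2 = finset.set0) (hA13 : A1 :&: A3 = finset.set0)
  (hA23 : A2 :&: A3 = finset.set0)
  (hA : A1 :|: A2 :|: A3 = [set: 'I_n]%SET)
  (mu1 mu2 mu3 : nat) (hmu : (mu1 + mu2 + mu3 = k)%N)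
  (hmu1 : (1 <= mu1 <= #|A1| - 1)%N)
  (hmu2 : (1 <= mu2 <= #|A2| - 1)%N)
  (hmu3 : (1 <= mu3 <= #|A3| - 1)%N) :
  let Delta := hypersimplex R n k in
  let P1 := [set x | [/\ Delta x, \sum_(i in A3) x 0 i <= mu3%:R
                                & \sum_(i in A2) x 0 i >= mu2%:R]] in
  let P2 := [set x | [/\ Delta x, \sum_(i in A1) x 0 i <= mu1%:R
                                & \sum_(i in A3) x 0 i >= mu3%:R]] in
  let P3 := [set x | [/\ Delta x, \sum_(i in A2) x 0 i <= mu2%:R
                                & \sum_(i in A1) x 0 i >= mu1%:R]] in
  let Q1 := [set x | [/\ Delta x, \sum_(i in A3) x 0 i >= mu3%:R
                                & \sum_(i in A2) x 0 i <= mu2%:R]] in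
  let Q2 := [set x | [/\ Delta x, \sum_(i in A1) x 0 i >= mu1%:R
                                & \sum_(i in A3) x 0 i <= mu3%:R]] in
  let Q3 := [set x | [/\ Delta x, \sum_(i in A2) x 0 i >= mu2%:R
                                & \sum_(i in A1) x 0 i <= mu1%:R]] in
  let SigmaP := face_complex [set P1; P2; P3] in
  let SigmaQ := face_complex [set Q1; Q2; Q3] in
  [/\ maximal_cells SigmaP = [set P1; P2; P3],
      three_split Delta SigmaP
    & matroid_subdivision Delta SigmaP] /\
  [/\ maximal_cells SigmaQ = [set Q1; Q2; Q3],
      three_split Delta SigmaQ
    & matroid_subdivision Delta SigmaQ].
Proof.
subst k => Delta P1 P2 P3 Q1 Q2 Q3 SigmaP SigmaQ.
split; first exact: three_split_cyclic_sectors.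
have A32 : A3 :&: A2 = finset.set0 by rewrite finset.setIC.
have cover132 : A1 :|: A3 :|: A2 = [set: 'I_n]%SET by rewrite finset.setUAC.
have := three_split_cyclic_sectors R hA13 hA12 A32 cover132 hmu1 hmu3 hmu2.
suff -> : cyclic_sectors A1 A3 A2 mu1 mu3 mu2 = [set Q1; Q2; Q3] by rewrite addnAC.
have sectorC (k : nat) (A B : {set 'I_n}) (a b : nat) : sector k A B a b =
    [set x : 'rV[R]_n | [/\ hypersimplex R n k x, b%:R <= set_sum B x
                          & set_sum A x <= a%:R]].
  by apply/seteqP; split=> x [].
by rewrite /cyclic_sectors addnAC setUAC !sectorC.
Qed.
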